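(* Fix a line $l\in\mathcal{L}'$ and $\tau>0$, and let $x,x^\star_l\in\mathbb{R}^d$ and $y\in\mathbb{R}^{m-d}$ be such that $\nabla^2_{xx}\mathcal{H}(x,y)\succ0$ and $\Theta_l(x,y)<\Theta_l^{\max}$. Let $$\widehat{\mathcal{H}}(z):=\mathcal{H}(x,y)+\tfrac12(z-x)^\top\nabla^2_{xx}\mathcal{H}(x,y)(z-x),\qquad z\in\mathbb{R}^d,$$ be the quadratic Taylor model of the energy function centered at $x$. Let $\nabla^2_{xx}\Theta_l(x^\star_l,y)=Q_lK_lQ_l^\top$ with $Q_l\in\mathbb{R}^{d\times r_l}$ and $K_l\in\mathbb{R}^{r_l\times r_l}$ diagonal, and put $A_l:=K_lQ_l^\top[\nabla^2_{xx}\mathcal{H}(x,y)]^{-1}Q_l\in\mathbb{R}^{r_l\times r_l}$. Suppose that $x^\star_l$ and a scalar $\mu^\star_l\ge0$ satisfy $$\nabla^2_{xx}\mathcal{H}(x,y)(x^\star_l-x)=\mu^\star_l\nabla_x\Theta_l(x^\star_l,y),\qquad \Theta_l(x^\star_l,y)=\Theta_l^{\max},\qquad \mu^\star_l\,\rho(A_l)<1,$$ where $\rho$ is the spectral radius. Let the prefactors $\mathsf{pf}^0_l,\mathsf{pf}^1_l$ and the energy factor $\mathsf{ef}_l$ of the failure rate of line $l$ be given (with equilibrium point $x$ and with energy $\widehat{\mathcal{H}}$) by $$\mathsf{pf}^1_l=\mathsf{pf}^0_l\left(1+\frac{\tau}{\widehat{\mathcal{H}}(x^\star_l)-\widehat{\mathcal{H}}(x)}\right),\qquad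 \mathsf{pf}^0_l=\left\|\nabla\widehat{\mathcal{H}}(x^\star_l)\right\|_S^2\sqrt{\frac{\det\nabla^2\widehat{\mathcal{H}}(x)}{2\pi\tau\, C^\star_l}},\qquad \mathsf{ef}_l=\exp\left[-\frac{\widehat{\mathcal{H}}(x^\star_l)-\widehat{\mathcal{H}}(x)}{\tau}\right],$$ $$C^\star_l=\nabla\widehat{\mathcal{H}}(x^\star_l)^\top\,\mathrm{adj}(X_l)\,\nabla\widehat{\mathcal{H}}(x^\star_l),\qquad X_l=\nabla^2\widehat{\mathcal{H}}(x^\star_l)-\mu^\star_l\nabla^2_{xx}\Theta_l(x^\star_l,y).$$ Define $W_l:=I-\mu^\star_lA_l\in\mathbb{R}^{r_l\times r_l}$ and the scalars $$\alpha_l:=(x^\star_l-x)^\top\nabla_x\Theta_l(x^\star_l,y),\qquad \beta_l:=(x^\star_l-x)^\top Q_l\,\mathrm{adj}(W_l)\,K_l\,Q_l^\top(x^\star_l-x).$$ Then $$\mathsf{pf}^1_l=\mathsf{pf}^0_l\left(1+\frac{2\tau}{\mu^\star_l\alpha_l}\right),\qquad \mathsf{pf}^0_l=\frac{(\mu^\star_l)^{3/2}\,\|\nabla_x\Theta_l(x^\star_l,y)\|_S^2}{\sqrt{2\pi\tau\left(\alpha_l\det(W_l)+\beta_l\right)}},\qquad \mathsf{ef}_l=\exp\left(-\frac{\mu^\star_l\alpha_l}{2\tau}\right).$$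
   Context: Network. $\mathcal{N}=\{1,\dots,n_b\}$ is the set of buses, $\mathcal{L}\subseteq\mathcal{N}\times\mathcal{N}$ the set of lines $l=(i,j)$, $\mathcal{G}=\{1,\dots,n_g\}$ the set of generators, $\mathcal{G}_i\subseteq\mathcal{G}$ the generators at bus $i$. $\mathcal{N}'=\{i\in\mathcal{N}:\mathcal{G}_i=\emptyset\}$ is the set of non-generator buses and $\mathcal{L}'=\{(i,j)\in\mathcal{L}:\mathcal{G}_i=\emptyset\text{ or }\mathcal{G}_j=\emptyset\}$. The network is lossless: the nodal admittance matrix is $Y=\sqrt{-1}\,B$ with $B\in\mathbb{R}^{n_b\times n_b}$. A slack/reference bus $\sigma\in\mathcal{N}\setminus\mathcal{N}'$ with $|\mathcal{G}_\sigma|=1$ is fixed. Variables. Voltage magnitudes $V\in\mathbb{R}^{n_b}$, angles $\theta\in\mathbb{R}^{n_b}$, generator angular velocities $\omega\in\mathbb{R}^{n_g}$, active and reactive generation $p_g,q_g\in\mathbb{R}^{n_g}$, and fixed demands $p_d,q_d\in\mathbb{R}^{n_b}$; $p_{net,i}=p_{d,i}-\sum_{k\in\mathcal{G}_i}p_{g,k}$ and $q_{net,i}=q_{d,i}-\sum_{k\in\mathcal{G}_i}q_{g,k}$. The system variables $(p_g,q_g,V,\theta,\omega)\in\mathbb{R}^m$, $m=3n_g+2n_b$, are partitioned as $x=(\{V_i\}_{i\in\mathcal{N}'},\{\theta_i\}_{i\in\mathcal{N}\setminus\{\sigma\}},\{\omega_i\}_{i\in\mathcal{G}\setminus\mathcal{G}_\sigma})\in\mathbb{R}^d$,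 with $d=|\mathcal{N}'|+|\mathcal{N}|+|\mathcal{G}|-2$, and $y=(\{V_i\}_{i\in\mathcal{N}\setminus\mathcal{N}'},\theta_\sigma,\omega_\sigma,p_g,q_g)\in\mathbb{R}^{m-d}$. Energy function. For voltage magnitudes $V_i>0$, $$\mathcal{H}(x,y)=\tfrac12\omega^\top M\omega-\tfrac12\sum_{i,j\in\mathcal{N}}B_{ij}V_iV_j\cos(\theta_i-\theta_j)+p_{net}^\top\theta+\sum_{i\in\mathcal{N}}q_{net,i}\log V_i,$$ where $M$ is the $n_g\times n_g$ diagonal matrix of generator masses. The point $x$ (with $y$) at which the Hessian of $\mathcal{H}$ is taken has positive voltage magnitudes. $\nabla_x$, $\nabla^2_{xx}$ denote the gradient and Hessian with respect to the first argument in $\mathbb{R}^d$. (The Taylor model has no first-order term because, in the application, $x$ is an equilibrium, $\nabla_x\mathcal{H}(x,y)=0$.) Line failure function. For $l=(i,j)$, $$\Theta_l(x,y)=|Y_{ij}|^2\left(V_i^2+V_j^2-2V_iV_j\cos(\theta_i-\theta_j)\right),\qquad \Theta_l^{\max}=(I_l^{\mathrm{trip}})^2>0,$$ where $I_l^{\mathrm{trip}}>0$ is the emergency current rating of line $l$. Other notation. $S\in\mathbb{R}^{d\times d}$ is a fixed symmetric positive semidefinite matrix (the diffusion matrix of the stochastic dynamics $\mathrm{d}x_t=(J-S)\nabla_x\mathcal{H}\,\mathrm{d}t+\sqrt{2\tau S}\,\mathrm{d}W_t$), and $\|z\|_S=\sqrt{z^\top Sz}$. $\mathrm{adj}$ is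 the adjugate matrix. The failure rate of line $l$ is $\lambda^\tau_l=\mathsf{pf}^1_l\times\mathsf{ef}_l$. *)

(* Defs.v *)
From HB Require Import structures.
From mathcomp Require Import all_boot all_order all_algebra.
From mathcomp Require Import all_classical all_reals all_analysis.
From mathcomp.real_closed Require Import complex.
From mathcomp Require Import zify.

Set Implicit Arguments.
Unset Strict Implicit.
Unset Printing Implicit Defensive.

Import Order.TTheory GRing.Theory Num.Theory.
Import numFieldNormedType.Exports.

Local Open Scope ring_scope.

Section calculus.
Variable R : realType.

Definition bilin d (u : 'cV[R]_d) (A : 'M[R]_d) (v : 'cV[R]_d) : R :=
  (u^T *m A *m v) 0 0.

Definition dotp d (u v : 'cV[R]_d) : R := (u^T *m v) 0 0.

Definition posdef d (A : 'M[R]_d) : Prop :=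
  A^T = A /\ forall u : 'cV[R]_d, u != 0 -> 0 < bilin u A u.

Definition possemidef d (A : 'M[R]_d) : Prop :=
  A^T = A /\ forall u : 'cV[R]_d, 0 <= bilin u A u.

Definition snorm d (S : 'M[R]_d) (u : 'cV[R]_d) : R := Num.sqrt (bilin u S u).

Definition partial d (f : 'cV[R]_d -> R) (i : 'I_d) (x : 'cV[R]_d) : R :=
  'D_(delta_mx i 0) f x.

Definition grad d (f : 'cV[R]_d -> R) (x : 'cV[R]_d) : 'cV[R]_d :=
  \col_i partial f i x.

Definition hessian d (f : 'cV[R]_d -> R) (x : 'cV[R]_d) : 'M[R]_d :=
  \matrix_(i, j) partial (partial f j) i x.

(* Second-order Taylor model at x without its first-order term. *)
Definition taylor_model d (f : 'cV[R]_d -> R) (x z : 'cV[R]_d) : R :=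
  f x + 2^-1 * bilin (z - x) (hessian f x) (z - x).

(* Eigenvalues are taken over the complex numbers R[i]; for the empty matrix
   the set is empty and its sup is 0. *)
Definition spectral_radius n (A : 'M[R]_n) : R :=
  sup [set ComplexField.Normc.normc a
      | a in [set a : R[i] | eigenvalue (map_mx (real_complex R) A) a]]%classic.

End calculus.

Section network.
Variable R : realType.

Record network := Network {
  nb : nat;
  ng : nat;
  lines : {set 'I_nb * 'I_nb};
  gens : 'I_nb -> {set 'I_ng};
  susceptance : 'M[R]_nb;
  masses : 'rV[R]_ng;
  pd : 'cV[R]_nb;
  qd : 'cV[R]_nb;
  Itrip : 'I_nb * 'I_nb -> R;
  Itrip_gt0 : forall l, l \in lines -> 0 < Itrip l;
  slack : 'I_nb;
  card_gens_slack : #|gens slack| = 1%N }.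

Implicit Type N : network.

Definition nongen N : {set 'I_(nb N)} := [set i | gens i == finset.set0].

Definition nongen_lines N : {set 'I_(nb N) * 'I_(nb N)} :=
  [set l in lines N | (gens l.1 == finset.set0) || (gens l.2 == finset.set0)].

Lemma slack_notin_nongen N : slack N \notin nongen N.
Proof.
by rewrite inE; apply/eqP => s0; have := card_gens_slack N; rewrite s0 cards0.
Qed.

Definition admittance N : 'M[R[i]]_(nb N) :=
  \matrix_(i, j) (Complex 0 1 * real_complex R (susceptance N i j)).

(* Coordinates of x, in order: V on the non-generator buses, theta off the
   slack bus, omega off the slack generator. *)
Definition dimx N : nat :=
  (#|nongen N| + (#|~: [set slack N]%SET| + #|~: gens (slack N)|))%N.

(* Coordinates of y, in order: V on the generator buses, theta at the slack
   bus, omega of the slack generator, p_g, q_g. *)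
Definition dimy N : nat :=
  (#|~: nongen N| + (1 + (1 + (ng N + ng N))))%N.

Lemma dimxE N : dimx N = (#|nongen N| + nb N + ng N - 2)%N.
Proof.
have := cardsC [set slack N]%SET; have := cardsC (gens (slack N)).
rewrite card_gens_slack cards1 /dimx.
have -> : #|'I_(nb N)| = nb N by exact: card_ord.
have -> : #|'I_(ng N)| = ng N by exact: card_ord.
by lia.
Qed.

Lemma dimxDdimy N : (dimx N + dimy N = 3 * ng N + 2 * nb N)%N.
Proof.
have := cardsC [set slack N]%SET; have := cardsC (gens (slack N)).
have := cardsC (nongen N); rewrite card_gens_slack cards1 /dimx /dimy.
have -> : #|'I_(nb N)| = nb N by exact: card_ord.
have -> : #|'I_(ng N)| = ng N by exact: card_ord.
by lia.
Qed.

(* The function on T whose value at the j-th element of A is v_j (and 0 off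
   A): the sum has exactly one term when t is in A. *)
Definition extend (T : finType) (A : {set T}) (v : 'cV[R]_#|A|) (t : T) : R :=
  \sum_(j < #|A| | enum_val j == t) v j 0.

Lemma extend_enum_val (T : finType) (A : {set T}) (v : 'cV[R]_#|A|)
  (j : 'I_#|A|) : extend v (enum_val j) = v j 0.
Proof.
rewrite /extend (bigD1 j) //= big1 ?addr0 // => k /andP[/eqP /enum_val_inj ->].
by rewrite eqxx.
Qed.

Section state.
Variables (N : network) (x : 'cV[R]_(dimx N)) (y : 'cV[R]_(dimy N)).

Definition volt (i : 'I_(nb N)) : R :=
  if i \in nongen N then extend (usubmx x) i else extend (usubmx y) i.

Definition angle (i : 'I_(nb N)) : R :=
  if i == slack N then usubmx (dsubmx y) 0 0
  else extend (usubmx (dsubmx x)) i.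

Definition angvel : 'cV[R]_(ng N) :=
  \col_k if k \in gens (slack N) then usubmx (dsubmx (dsubmx y)) 0 0
         else extend (dsubmx (dsubmx x)) k.

Definition pgen : 'cV[R]_(ng N) := usubmx (dsubmx (dsubmx (dsubmx y))).

Definition qgen : 'cV[R]_(ng N) := dsubmx (dsubmx (dsubmx (dsubmx y))).

Definition pnet (i : 'I_(nb N)) : R :=
  pd N i 0 - \sum_(k in gens i) pgen k 0.

Definition qnet (i : 'I_(nb N)) : R :=
  qd N i 0 - \sum_(k in gens i) qgen k 0.

(* Meaningful for positive voltage magnitudes: ln is 0 on nonpositive reals. *)
Definition energy : R :=
  2^-1 * bilin angvel (diag_mx (masses N)) angvel
  - 2^-1 * (\sum_i \sum_j susceptance N i j * volt i * volt j
              * cos (angle i - angle j))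
  + \sum_i pnet i * angle i
  + \sum_i qnet i * ln (volt i).

Definition line_fail (l : 'I_(nb N) * 'I_(nb N)) : R :=
  ComplexField.Normc.normc (admittance N l.1 l.2) ^+ 2
  * (volt l.1 ^+ 2 + volt l.2 ^+ 2
     - 2 * volt l.1 * volt l.2 * cos (angle l.1 - angle l.2)).

End state.

Definition line_fail_max N (l : 'I_(nb N) * 'I_(nb N)) : R := Itrip l ^+ 2.

End network.

(* Factors of the failure rate for the energy E and the failure surface
   Theta = const, from the equilibrium xb, through the point xs of the surface
   with multiplier mu, at temperature tau and diffusion matrix S. *)
Section failure_rate.
Variables (R : realType) (d : nat) (S : 'M[R]_d) (tau : R).
Variables (E Theta : 'cV[R]_d -> R) (xb xs : 'cV[R]_d) (mu : R).

Definition lagrangian_hessian : 'M[R]_d :=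
  hessian E xs - mu *: hessian Theta xs.

Definition curvature_factor : R :=
  bilin (grad E xs) (\adj lagrangian_hessian) (grad E xs).

Definition prefactor0 : R :=
  snorm S (grad E xs) ^+ 2
  * Num.sqrt (\det (hessian E xb) / (2 * pi * tau * curvature_factor)).

Definition prefactor1 : R := prefactor0 * (1 + tau / (E xs - E xb)).

Definition energy_factor : R := expR (- ((E xs - E xb) / tau)).

End failure_rate.

(* Main.v *)
Require Import Defs.
From HB Require Import structures.
From mathcomp Require Import all_boot all_order all_algebra.
From mathcomp Require Import all_classical all_reals all_analysis.
From mathcomp.real_closed Require Import complex.
From mathcomp Require Import ring.

Set Implicit Arguments.
Unset Strict Implicit.
Unset Printing Implicit Defensive.

Import Order.TTheory GRing.Theory Num.Theory.
Import numFieldNormedType.Exports.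

Local Open Scope ring_scope.

(** The Taylor model [Hhat] is a quadratic form centred at [x], with the
symmetric Hessian [H] of the energy at [x]: its gradient is [H *m (z - x)] and
its Hessian is [H] everywhere.  By the stationarity condition, the gradient at
[xs] is [mu *: g] with [g] the gradient of the line failure function, and the
energy gap is [(xs - x)^T H (xs - x) / 2 = mu * alpha / 2].  This gives the
formulas for [pf1] and [ef] by substitution.

For [pf0], what has to be computed is the quadratic form at [H (xs - x)] of
the adjugate of [H - mu Q K Q^T], a perturbation of [H] of rank at most [r].
The Weinstein-Aronszajn identity for its determinant and the Woodbury formula
for its inverse combine ([adj_sub_mulmx]) into an expression where only
[det H], the inverse of [H] and the [r] by [r] matrix [W] occur; in the
quadratic form the inverses of [H] cancel against the factors [H], and the
value is [mu * det H * (alpha * det W + beta)] ([curvature_lowrank]).  The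
factor [det H] then cancels, and the powers of [mu] are collected from the
squared norm of [mu *: g] and from the square root.

The division by [det W] implicit in Woodbury's formula is legitimate because
[W] is singular only if [mu^-1] is an eigenvalue of [A], which the bound
[mu * spectral_radius A < 1] excludes ([unitmx_1subZ]).  Finally [mu] is
positive, not only nonnegative: [mu = 0] would force [xs = x], whereas the two
points lie on different level sets of the line failure function. *)

(** * Adjugate of a low-rank perturbation *)

Section adjugate.
Variable R : comUnitRingType.

(** The Weinstein-Aronszajn identity: both sides are the determinant of the
block matrix with diagonal blocks [1] and off-diagonal blocks [U], [V],
eliminated in the two possible orders. *)
Lemma det_1sub_mulmxC m n (U : 'M[R]_(m, n)) (V : 'M[R]_(n, m)) :
  \det (1%:M - U *m V) = \det (1%:M - V *m U).
Proof.
have : block_mx (1%:M - U *m V) U 0 1%:M *m block_mx 1%:M 0 V 1%:M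
     = block_mx 1%:M 0 V 1%:M *m block_mx 1%:M U 0 (1%:M - V *m U).
  rewrite !mulmx_block !(mulmx1, mul1mx, mulmx0, mul0mx, addr0, add0r).
  by rewrite !subrK [V *m U + _]addrC subrK.
move/(congr1 determinant).
by rewrite !det_mulmx !det_ublock !det_lblock !det1 !(mulr1, mul1r).
Qed.

Lemma adj_of_mulmx1 n (X Z : 'M[R]_n) : X *m Z = 1%:M -> \adj X = \det X *: Z.
Proof.
by move=> XZ; rewrite -[LHS]mulmx1 -XZ mulmxA mul_adj_mx mul_scalar_mx.
Qed.

(** Woodbury's formula multiplied by the determinant of the perturbed matrix,
which is [\det H * \det W]. *)
Lemma adj_sub_mulmx m n (H : 'M[R]_m) (U : 'M[R]_(m, n)) (V : 'M[R]_(n, m)) :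
  let W := 1%:M - V *m invmx H *m U in
  H \in unitmx -> W \in unitmx ->
  \adj (H - U *m V) = \det H *: (\det W *: invmx H
                      + invmx H *m U *m \adj W *m V *m invmx H).
Proof.
move=> W uH uW.
have detX : \det (H - U *m V) = \det H * \det W.
  have -> : H - U *m V = (1%:M - U *m (V *m invmx H)) *m H.
    by rewrite mulmxBl mul1mx -!mulmxA mulVmx // mulmx1.
  by rewrite det_mulmx det_1sub_mulmxC mulrC.
have adjW : \adj W = \det W *: invmx W by apply: adj_of_mulmx1; rewrite mulmxV.
rewrite (@adj_of_mulmx1 _ _
  (invmx H + invmx H *m U *m invmx W *m V *m invmx H)); last first.
  (* Woodbury's inverse; the terms cancel since V H^-1 U W^-1 = W^-1 - 1. *)
  have VHU : V *m invmx H *m U = 1%:M - W by rewrite opprB addrC subrK.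
  rewrite mulmxBl mulmxDr mulmxV // !mulmxA mulmxV // mul1mx mulmxDr.
  have -> : U *m V *m (invmx H *m U *m invmx W *m V *m invmx H)
          = U *m invmx W *m V *m invmx H - U *m V *m invmx H.
    rewrite -!mulmxA (mulmxA V) (mulmxA (V *m _)) VHU mulmxBl mul1mx mulmxBr.
    by rewrite (mulKVmx uW).
  by rewrite addrCA subrr addr0 addrK.
by rewrite detX adjW -scalemxAr -!scalemxAl -scalerDr scalerA.
Qed.
End adjugate.

(** * Derivatives of the quadratic Taylor model *)

Section quadratic.
Local Open Scope classical_set_scope.
Variables (R : realType) (d : nat).
Implicit Types (f : 'cV[R]_d -> R) (x v : 'cV[R]_d).

(** The difference quotient along [v] is [a + h * b], so that no
differentiability of [f] has to be established beforehand. *)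
Lemma derive_quadratic f x v (a b : R) :
  (forall h, f (h *: v + x) = f x + h * a + h ^+ 2 * b) -> 'D_v f x = a.
Proof.
move=> fE; rewrite /derive.
apply: cvg_lim; first exact: Rhausdorff.
have lin : (fun h : R => a + h * b) @ 0^' --> a.
  rewrite -[X in _ --> X]addr0 -[X in _ --> a + X](mul0r b).
  apply: cvgD; first exact: cvg_cst.
  by apply: cvgM; [exact: cvg_within | exact: cvg_cst].
apply: cvg_trans lin; apply: near_eq_cvg; near=> h.
have h0 : h != 0 by near: h; exact: nbhs_dnbhs_neq.
rewrite /= fE.
have -> : f x + h * a + h ^+ 2 * b - f x = h * (a + h * b) by ring.
by rewrite /GRing.scale /= mulKf.
Unshelve. all: by end_near.
Qed.

Lemma bilinDZl (u v w : 'cV[R]_d) (h : R) (A : 'M[R]_d) :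
  bilin (h *: v + u) A w = h * bilin v A w + bilin u A w.
Proof.
by rewrite /bilin linearD linearZ /= !mulmxDl -!scalemxAl !mxE.
Qed.

Lemma bilinDZr (u v w : 'cV[R]_d) (h : R) (A : 'M[R]_d) :
  bilin w A (h *: v + u) = h * bilin w A v + bilin w A u.
Proof. by rewrite /bilin mulmxDr -scalemxAr !mxE. Qed.

Lemma bilin_sym (A : 'M[R]_d) (u v : 'cV[R]_d) :
  A^T = A -> bilin u A v = bilin v A u.
Proof.
move=> As; rewrite /bilin -[in LHS](trmxK (_ *m v)) [LHS]mxE.
by rewrite !trmx_mul trmxK As mulmxA.
Qed.

Lemma bilin_delta (A : 'M[R]_d) i (u : 'cV[R]_d) :
  bilin (delta_mx i 0) A u = (A *m u) i 0.
Proof. by rewrite /bilin trmx_delta -mulmxA -rowE mxE. Qed.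

(** Along the line through [z] in direction [e_i] the model is a quadratic
polynomial; symmetry of the Hessian merges its two cross terms. *)
Lemma partial_taylor_model f x i z : (hessian f x)^T = hessian f x ->
  partial (taylor_model f x) i z = (hessian f x *m (z - x)) i 0.
Proof.
move=> Hs; apply: (@derive_quadratic _ _ _ _
  (2^-1 * bilin (delta_mx i 0) (hessian f x) (delta_mx i 0))) => h.
rewrite /taylor_model -[h *: _ + z - x]addrA bilinDZl !bilinDZr.
rewrite (bilin_sym (z - x) (delta_mx i 0) Hs) -bilin_delta.
set p := bilin _ _ (delta_mx i 0); set q := bilin _ _ (z - x).
set s := bilin _ _ (z - x).
by field.
Qed.

Lemma grad_taylor_model f x z : (hessian f x)^T = hessian f x ->
  grad (taylor_model f x) z = hessian f x *m (z - x).
Proof.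
by move=> Hs; apply/colP => i; rewrite mxE partial_taylor_model.
Qed.

(** By [partial_taylor_model] each first partial derivative is an affine
function, whose derivatives are the entries of the Hessian. *)
Lemma hessian_taylor_model f x z : (hessian f x)^T = hessian f x ->
  hessian (taylor_model f x) z = hessian f x.
Proof.
move=> Hs; apply/matrixP => i j; rewrite mxE.
have -> : partial (taylor_model f x) j = fun u => (hessian f x *m (u - x)) j 0.
  by apply/funext => u; exact: partial_taylor_model.
move: (hessian f x) Hs => H Hs.
apply: (@derive_quadratic _ _ _ _ 0) => h.
rewrite -[h *: _ + z - x]addrA mulmxDr -scalemxAr -colE mulr0 addr0.
by rewrite -[in RHS]Hs !mxE addrC Hs.
Qed.

Lemma posdef_unitmx (A : 'M[R]_d) : posdef A -> A \in unitmx.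
Proof.
move=> [_ Apos]; rewrite -row_free_unit -kermx_eq0; apply/rowV0P => u.
move/sub_kermxP => uA; apply/eqP; apply: contraT => u0.
have := Apos u^T; rewrite trmx_eq0 => /(_ u0).
by rewrite /bilin trmxK uA mul0mx mxE ltxx.
Qed.

End quadratic.

(** * The spectral radius *)

Section spectral.
Variable R : realType.
Local Notation normc := ComplexField.Normc.normc.

(** The [sup] defining the spectral radius is an upper bound only because the
moduli of the eigenvalues are bounded: the eigenvalues are among the roots of
the characteristic polynomial, which splits over [R[i]], and the sum of the
moduli of these roots is a bound. *)
Lemma eigenvalue_le_spectral_radius n (A : 'M[R]_n) (a : R) :
  eigenvalue A a -> a <= spectral_radius A.
Proof.
move=> Aa; pose AC := map_mx (real_complex R) A.
have ACa : eigenvalue AC (real_complex R a).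
  by rewrite !eigenvalue_root_char in Aa *; rewrite -map_char_poly fmorph_root.
apply: (@le_trans _ _ (normc (real_complex R a))).
  by rewrite /= expr0n addr0 sqrtr_sqr ler_norm.
apply: sup_upper_bound; last by exists (real_complex R a).
split; first by exists (normc (real_complex R a)), (real_complex R a).
have [rs rsE] := closed_field_poly_normal (char_poly AC).
exists (\sum_(z <- rs) normc z) => _ [b /= bP <-].
have {bP} : b \in rs.
  move: bP; rewrite eigenvalue_root_char rsE (monicP (char_poly_monic _)).
  by rewrite scale1r root_prod_XsubC.
move=> brs; rewrite (big_rem b) //= lerDl sumr_ge0 // => c _.
by case: c => p q /=; rewrite sqrtr_ge0.
Qed.

(** Otherwise [mu^-1] would be an eigenvalue of [A], hence at most the spectral
radius. *)
Lemma unitmx_1subZ n (A : 'M[R]_n) (mu : R) : 0 < mu ->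
  mu * spectral_radius A < 1 -> 1%:M - mu *: A \in unitmx.
Proof.
move=> mu0 rho.
have -> : 1%:M - mu *: A = (- mu) *: (A - mu^-1%:M).
  rewrite scalerBr scale_scalar_mx mulNr mulfV ?gt_eqF //.
  by rewrite scaleNr raddfN opprK addrC.
rewrite unitmxZ ?unitfE ?oppr_eq0 ?gt_eqF // -row_free_unit -kermx_eq0.
apply: contraLR rho => Amu.
rewrite -leNgt -ler_pdivrMl // mulr1.
exact: eigenvalue_le_spectral_radius.
Qed.
End spectral.

(** * The failure rate *)

(** This extends [sqrtrV] to negative [a]: both square roots are then [0].  The
sign of the curvature factor therefore never has to be determined. *)
Lemma sqrt_recip (R : rcfType) (a : R) : Num.sqrt a^-1 = (Num.sqrt a)^-1.
Proof.
have [a0|a0] := leP 0 a; first exact: sqrtrV.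
by rewrite !ltr0_sqrtr ?invr0 ?invr_lt0.
Qed.

Lemma powR_3half (R : realType) (m : R) : 0 < m ->
  m `^ (3 / 2) = m ^+ 2 / Num.sqrt m.
Proof.
move=> m0; rewrite -powR12_sqrt ?ltW // -powR_mulrn ?ltW // -powRN -powRD.
  by congr (_ `^ _); field.
by rewrite (gt_eqF m0) implybT.
Qed.

Lemma snormZ (R : realType) d (S : 'M[R]_d) (c : R) u :
  possemidef S -> snorm S (c *: u) ^+ 2 = c ^+ 2 * snorm S u ^+ 2.
Proof.
move=> [_ S0]; rewrite /snorm !sqr_sqrtr // /bilin.
rewrite [(c *: u)^T]linearZ /= -!scalemxAl.
by rewrite -scalemxAr !mxE expr2 mulrA.
Qed.

(** The curvature factor when the line failure function has the Hessian
[Q *m K *m Q^T] and the gradient [g], with [u] the displacement from the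
equilibrium.  By stationarity [u^T H u = mu * dotp u g], whence the overall
factor [mu]. *)
Lemma curvature_lowrank (R : realType) (d r : nat) (H : 'M[R]_d)
    (Q : 'M[R]_(d, r)) (K : 'M[R]_r) (mu : R) (g u : 'cV[R]_d) :
  let W := 1%:M - mu *: (K *m Q^T *m invmx H *m Q) in
  posdef H -> H *m u = mu *: g -> W \in unitmx ->
  bilin (H *m u) (\adj (H - mu *: (Q *m K *m Q^T))) (H *m u) =
  mu * \det H * (dotp u g * \det W + dotp u (Q *m \adj W *m K *m Q^T *m u)).
Proof.
move=> W Hpos stat uW; have uH := posdef_unitmx Hpos; have [Hs _] := Hpos.
have -> : mu *: (Q *m K *m Q^T) = Q *m (mu *: (K *m Q^T)).
  by rewrite -scalemxAr mulmxA.
have WE : W = 1%:M - (mu *: (K *m Q^T)) *m invmx H *m Q.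
  by rewrite -!scalemxAl.
have := @adj_sub_mulmx _ _ _ _ Q (mu *: (K *m Q^T)) uH.
rewrite /= -WE => -> //.
have E : (H *m u)^T *m (\det H *: (\det W *: invmx H +
    invmx H *m Q *m \adj W *m (mu *: (K *m Q^T)) *m invmx H)) *m (H *m u)
  = \det H *: (\det W *: (u^T *m (H *m u))
               + mu *: (u^T *m (Q *m \adj W *m K *m Q^T *m u))).
  rewrite trmx_mul Hs -!scalemxAr -!scalemxAl; congr (_ *: _).
  rewrite mulmxDr mulmxDl -!scalemxAr -!scalemxAl.
  by rewrite !mulmxA !(mulmxK uH) (mulmxKV uH).
rewrite /bilin E stat -scalemxAr /dotp.
move: (u^T *m g) (u^T *m _) => a b; rewrite !mxE.
by ring.
Qed.

Theorem proposition2 (R : realType) (N : network R)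
  (l : 'I_(nb N) * 'I_(nb N)) (hl : l \in nongen_lines N)
  (tau : R) (htau : 0 < tau)
  (S : 'M[R]_(dimx N)) (hS : possemidef S)
  (x xs : 'cV[R]_(dimx N)) (y : 'cV[R]_(dimy N))
  (hV : forall i : 'I_(nb N), 0 < volt x y i)
  (hH : posdef (hessian (fun z => energy z y) x))
  (hTheta : line_fail x y l < line_fail_max l)
  (r : nat) (Q : 'M[R]_(dimx N, r)) (K : 'M[R]_r)
  (hK : is_diag_mx K)
  (hQK : hessian (fun z => line_fail z y l) xs = Q *m K *m Q^T)
  (mu : R) (hmu : 0 <= mu)
  (hstat : hessian (fun z => energy z y) x *m (xs - x)
           = mu *: grad (fun z => line_fail z y l) xs)
  (hact : line_fail xs y l = line_fail_max l) :
  let A := K *m Q^T *m invmx (hessian (fun z => energy z y) x) *m Q in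
  mu * spectral_radius A < 1 ->
  let Hhat := taylor_model (fun z => energy z y) x in
  let Theta := fun z => line_fail z y l in
  let pf0 := prefactor0 S tau Hhat Theta x xs mu in
  let pf1 := prefactor1 S tau Hhat Theta x xs mu in
  let ef := energy_factor tau Hhat x xs in
  let W := 1%:M - mu *: A in
  let alpha := dotp (xs - x) (grad Theta xs) in
  let beta := dotp (xs - x) (Q *m \adj W *m K *m Q^T *m (xs - x)) in
  [/\ pf1 = pf0 * (1 + 2 * tau / (mu * alpha)),
      pf0 = mu `^ (3 / 2) * snorm S (grad Theta xs) ^+ 2
            / Num.sqrt (2 * pi * tau * (alpha * \det W + beta))
    & ef = expR (- (mu * alpha / (2 * tau)))].
Proof.
move=> A hrho Hhat Theta pf0 pf1 ef W alpha beta.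
have [Hs _] := hH.
have xs_neq : xs - x != 0.
  by apply: contraTneq hTheta => /subr0_eq xsx; rewrite -leNgt -xsx hact.
have mu0 : 0 < mu.
  rewrite lt0r hmu andbT; apply: contra xs_neq => /eqP mu0.
  by rewrite -(mulKmx (posdef_unitmx hH) (xs - x)) hstat mu0 scale0r mulmx0.
have dE : Hhat xs - Hhat x = mu * alpha / 2.
  have quad : bilin (xs - x) (hessian (fun z => energy z y) x) (xs - x)
      = mu * alpha by rewrite /bilin -mulmxA hstat -scalemxAr mxE.
  rewrite /Hhat /taylor_model quad subrr /bilin mulmx0 mxE mulr0 addr0.
  by rewrite [LHS]addrC addKr mulrC.
have pf0E : pf0 = mu `^ (3 / 2) * snorm S (grad Theta xs) ^+ 2
            / Num.sqrt (2 * pi * tau * (alpha * \det W + beta)).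
  rewrite /pf0 /prefactor0 /curvature_factor /lagrangian_hessian.
  rewrite !hessian_taylor_model // grad_taylor_model // hQK.
  rewrite (curvature_lowrank hH hstat) ?unitmx_1subZ //.
  rewrite hstat snormZ // powR_3half //.
  rewrite -/alpha -/beta -/W.
  set a := alpha * _ + _.
  have -> : \det (hessian (fun z => energy z y) x)
      / (2 * pi * tau * (mu * \det (hessian (fun z => energy z y) x) * a))
      = (mu * (2 * pi * tau * a))^-1.
    have := posdef_unitmx hH; rewrite unitmxE unitfE => D0.
    set D := \det _ in D0 *.
    by rewrite !invfM -[RHS]mulr1 -(mulfV D0); ring.
  by rewrite sqrt_recip sqrtrM ?ltW // invfM; ring.
split=> //.
  rewrite /pf1 /prefactor1 -/pf0 dE; congr (_ * (1 + _)).
  by rewrite invf_div mulrCA mulrA.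
by rewrite /ef /energy_factor dE -mulrA -invfM.
Qed.
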